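(* Let $d\ge 3$ be an odd integer. The group $G_d$ is of exponential word growth.
   Context: Let $d\ge 3$ be odd and $X=\{1,\dots,d\}$. Let $T$ be the $d$-regular rooted tree whose vertex set is the set $X^*$ of finite words over $X$, with root the empty word, the children of $u$ being $ux$, $x\in X$. $\mathrm{Aut}(T)$ is the group of root-preserving graph automorphisms of $T$, with product $gh(u)=h(g(u))$ and identity $e$. For $g\in\mathrm{Aut}(T)$ and $u\in X^*$, the section $g|_u\in\mathrm{Aut}(T)$ is determined by $g(uv)=g(u)\,g|_u(v)$ for all $v\in X^*$. The wreath recursion of $g$ is $g=(g|_1,\dots,g|_d)\lambda_g$, where $\lambda_g\in S_d$ is the permutation induced by $g$ on $X$; it determines $g$. The group $G_d\le \mathrm{Aut}(T)$ is generated by $A=\{a_1,\dots,a_d\}$, defined recursively by: for $1\le i\le d-1$, $\lambda_{a_i}=(i\ \,i+1)$, $a_i|_i=a_i$, $a_i|_{i+1}=a_{i+1}$, and $a_i|_x=e$ for all other $x\in X$; and $\lambda_{a_d}=(d\ 1)$, $a_d|_1=a_1$, $a_d|_d=a_d$, and $a_d|_x=e$ for all other $x\in X$. Exponential word growth means that the number of elements of $G_d$ expressible as words of length at most $n$ over $A\cup A^{-1}$ grows exponentially in $n$. *)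

(* Defs.v *)
From HB Require Import structures.
From mathcomp Require Import all_boot all_order all_algebra all_fingroup finmap.
From mathcomp Require Import boolp classical_sets functions cardinality reals.
Set Implicit Arguments.
Unset Strict Implicit.
Unset Printing Implicit Defensive.
Import Order.TTheory GRing.Theory Num.Theory.

Local Open Scope classical_set_scope.

(* The vertices of the d-regular rooted tree are the words over 'I_d; the
   letter j of {1, ..., d} is the ordinal of value j - 1. *)
Definition tree_adj (d : nat) (u v : seq 'I_d) : Prop :=
  (exists x, v = rcons u x) \/ (exists x, u = rcons v x).

Definition is_tree_aut (d : nat) (f : seq 'I_d -> seq 'I_d) : Prop :=
  [/\ bijective f, f [::] = [::]
    & forall u v, tree_adj (f u) (f v) <-> tree_adj u v].

Record tree_aut (d : nat) := TreeAut {
  tree_aut_fun :> seq 'I_d -> seq 'I_d;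
  tree_autP : is_tree_aut tree_aut_fun
}.

HB.instance Definition _ (d : nat) := gen_eqMixin (tree_aut d).
HB.instance Definition _ (d : nat) := gen_choiceMixin (tree_aut d).

Section AutGroup.
Variable d : nat.
Implicit Types (g h : tree_aut d) (u v : seq 'I_d).

Lemma tree_aut_ext g h : (forall u, g u = h u) -> g = h.
Proof.
case: g h => [f Pf] [f' Pf'] /= /funext e.
by case: _ / e Pf' => Pf'; congr TreeAut.
Qed.

Lemma is_tree_aut1 : is_tree_aut (@id (seq 'I_d)).
Proof. by split=> //; exists id. Qed.

Definition aut1 : tree_aut d := TreeAut is_tree_aut1.

Lemma is_tree_autM g h : is_tree_aut (h \o g).
Proof.
case: g h => [f [bf f0 fa]] [f' [bf' f'0 f'a]] /=; split.
- exact: bij_comp.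
- by rewrite /= f0 f'0.
- by move=> u v /=; rewrite f'a fa.
Qed.

(* Automorphisms act from the left to the right: (g * h) u = h (g u). *)
Definition autM g h : tree_aut d := TreeAut (is_tree_autM g h).

Lemma autV_ex g : exists h : tree_aut d, cancel g h /\ cancel h g.
Proof.
case: g => [f [[f' fK f'K] f0 fa]] /=.
suff P : is_tree_aut f' by exists (TreeAut P).
split; first by exists f.
- by rewrite -f0 fK.
- by move=> u v; rewrite -fa !f'K.
Qed.

Definition autV g : tree_aut d := sval (cid (autV_ex g)).

Lemma autKV g : cancel g (autV g).
Proof. by rewrite /autV; case: cid => h []. Qed.

Lemma autVK g : cancel (autV g) g.
Proof. by rewrite /autV; case: cid => h []. Qed.

Lemma autMA : associative autM.
Proof. by move=> f g h; apply: tree_aut_ext. Qed.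

Lemma aut1M : left_id aut1 autM.
Proof. by move=> g; apply: tree_aut_ext. Qed.

Lemma autM1 : right_id aut1 autM.
Proof. by move=> g; apply: tree_aut_ext. Qed.

Lemma autMV : right_inverse aut1 autV autM.
Proof. by move=> g; apply: tree_aut_ext => u /=; rewrite autKV. Qed.

Lemma autVM : left_inverse aut1 autV autM.
Proof. by move=> g; apply: tree_aut_ext => u /=; rewrite autVK. Qed.

End AutGroup.

HB.instance Definition _ (d : nat) :=
  isGroup.Build (tree_aut d)
    (@autMA d) (@aut1M d) (@autM1 d) (@autVM d) (@autMV d).

Section Sections.
Variable d : nat.
Implicit Types (g h : tree_aut d) (u v : seq 'I_d).

Lemma tree_aut_nil g : g [::] = [::].
Proof. by case: g => f []. Qed.

Lemma tree_aut_inj g : injective g.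
Proof. exact: can_inj (@autKV d g). Qed.

Lemma tree_aut_adj g u v : tree_adj (g u) (g v) <-> tree_adj u v.
Proof. by case: g => f []. Qed.

Lemma tree_adj_rcons u (x : 'I_d) : tree_adj u (rcons u x).
Proof. by left; exists x. Qed.

Lemma tree_aut_rcons_size g u (x : 'I_d) :
  (exists y, g (rcons u x) = rcons (g u) y) /\ size (g u) = size u.
Proof.
elim/last_ind: u x => [|u z IH] x.
  have /(tree_aut_adj g) := tree_adj_rcons [::] x.
  rewrite tree_aut_nil => -[[y e]|[y e]]; split=> //; first by exists y.
  by case: (g _) e.
have [[y gy] su] := IH z; split; last by rewrite gy !size_rcons su.
have /(tree_aut_adj g) [//|[y' gy']] := tree_adj_rcons (rcons u z) x.
have /rcons_inj[e _] : rcons (g u) y = rcons (g (rcons (rcons u z) x)) y'.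
  by rewrite -gy.
move/tree_aut_inj/(congr1 size)/eqP: e.
by rewrite !size_rcons -addn2 -[X in X == _]addn0 eqn_add2l.
Qed.

Lemma tree_aut_rcons g u (x : 'I_d) : exists y, g (rcons u x) = rcons (g u) y.
Proof. by have [] := tree_aut_rcons_size g u x. Qed.

Lemma tree_aut_size g u : size (g u) = size u.
Proof.
case: u => [|x u]; first by rewrite tree_aut_nil.
by have [] := tree_aut_rcons_size g (x :: u) x.
Qed.

Lemma tree_aut_cat g u v : g (u ++ v) = g u ++ drop (size u) (g (u ++ v)).
Proof.
elim/last_ind: v => [|v x IH].
  by rewrite cats0 drop_oversize ?cats0 // tree_aut_size.
rewrite -rcons_cat; have [y ->] := tree_aut_rcons g (u ++ v) x.
by rewrite IH rcons_cat drop_size_cat // tree_aut_size.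
Qed.

Definition section_fun g u v : seq 'I_d := drop (size u) (g (u ++ v)).

Lemma tree_adj_cat u v w : tree_adj (u ++ v) (u ++ w) <-> tree_adj v w.
Proof.
have E a b x : u ++ a = rcons (u ++ b) x <-> a = rcons b x.
  rewrite rcons_cat; split=> [/eqP|->//].
  by rewrite eqseq_cat // eqxx => /eqP.
by split=> -[[x /E e]|[x /E e]]; [left|right|left|right]; exists x => //; apply/E.
Qed.

Lemma is_tree_aut_section g u : is_tree_aut (section_fun g u).
Proof.
have E v : g (u ++ v) = g u ++ section_fun g u v by exact: tree_aut_cat.
split.
- exists (section_fun (autV g) (g u)) => v; rewrite /section_fun.
    by rewrite -E autKV drop_size_cat ?tree_aut_size.
  have := tree_aut_cat (autV g) (g u) v; rewrite autKV => <-.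
  by rewrite autVK drop_size_cat ?tree_aut_size.
- by rewrite /section_fun cats0 drop_oversize // tree_aut_size.
- move=> v w; rewrite -(tree_adj_cat (g u)) -!E.
  by rewrite tree_aut_adj tree_adj_cat.
Qed.

Definition section g u : tree_aut d := TreeAut (is_tree_aut_section g u).

Lemma sectionE g u v : g (u ++ v) = g u ++ section g u v.
Proof. exact: tree_aut_cat. Qed.

Lemma root_perm_subproof g : injective (fun x : 'I_d => head x (g [:: x])).
Proof.
move=> x y; have := tree_aut_size g [:: x]; have := tree_aut_size g [:: y].
case ey: (g [:: y]) => [//|y' []] //= _; case ex: (g [:: x]) => [//|x' []] //=.
by move=> _ e; have /tree_aut_inj[] : g [:: x] = g [:: y] by rewrite ex ey e.
Qed.

Definition root_perm g : {perm 'I_d} := perm (@root_perm_subproof g).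

Lemma root_permE g x : g [:: x] = [:: root_perm g x].
Proof. by rewrite permE; have := tree_aut_size g [:: x]; case: (g _) => [|?[]]. Qed.

Lemma wreathE g x v : g (x :: v) = root_perm g x :: section g [:: x] v.
Proof. by rewrite -[x :: v]cat1s sectionE root_permE. Qed.

End Sections.

Section Generators.
Variable d : nat.
Implicit Types (i : 'I_d) (u v : seq 'I_d).

(* ordS is the cyclic successor i |-> i + 1 mod d, so the last generator has
   root permutation (d 1), with sections a_1 at 1 and a_d at d. *)
Fixpoint gen_fun i u : seq 'I_d :=
  match u with
  | [::] => [::]
  | x :: v => tperm i (ordS i) x ::
      (if x == i then gen_fun i v
       else if x == ordS i then gen_fun (ordS i) v
       else v)
  end.

Fixpoint gen_inv_fun i u : seq 'I_d :=
  match u with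
  | [::] => [::]
  | y :: v => let x := tperm i (ordS i) y in x ::
      (if x == i then gen_inv_fun i v
       else if x == ordS i then gen_inv_fun (ordS i) v
       else v)
  end.

Lemma gen_funK i : cancel (gen_fun i) (gen_inv_fun i).
Proof.
move=> u; elim: u i => [//|x u IH] i /=; rewrite tpermK.
by case: eqP => _; rewrite ?IH //; case: eqP => _; rewrite ?IH.
Qed.

Lemma gen_inv_funK i : cancel (gen_inv_fun i) (gen_fun i).
Proof.
move=> u; elim: u i => [//|x u IH] i /=; rewrite tpermK.
by case: eqP => _; rewrite ?IH //; case: eqP => _; rewrite ?IH.
Qed.

Lemma gen_fun_rcons i u x : exists y, gen_fun i (rcons u x) = rcons (gen_fun i u) y.
Proof.
elim: u i x => [|z u IH] i x /=.
  by exists (tperm i (ordS i) x); do 2?case: eqP.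
case: eqP => _; first by have [y ->] := IH i x; exists y.
case: eqP => _; last by exists x.
by have [y ->] := IH (ordS i) x; exists y.
Qed.

Lemma gen_inv_fun_rcons i u x :
  exists y, gen_inv_fun i (rcons u x) = rcons (gen_inv_fun i u) y.
Proof.
elim: u i x => [|z u IH] i x /=.
  by exists (tperm i (ordS i) x); do 2?case: eqP.
case: eqP => _; first by have [y ->] := IH i x; exists y.
case: eqP => _; last by exists x.
by have [y ->] := IH (ordS i) x; exists y.
Qed.

Lemma is_tree_aut_gen i : is_tree_aut (gen_fun i).
Proof.
split=> //.
  by exists (gen_inv_fun i); [exact: gen_funK | exact: gen_inv_funK].
move=> u v; split=> -[[x e]|[x e]].
- left; have [y ey] := gen_inv_fun_rcons i (gen_fun i u) x.
  by exists y; rewrite -(gen_funK i v) e ey gen_funK.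
- right; have [y ey] := gen_inv_fun_rcons i (gen_fun i v) x.
  by exists y; rewrite -(gen_funK i u) e ey gen_funK.
- by left; rewrite e; exact: gen_fun_rcons.
- by right; rewrite e; exact: gen_fun_rcons.
Qed.

Definition gen i : tree_aut d := TreeAut (is_tree_aut_gen i).

Lemma root_perm_gen i : root_perm (gen i) = tperm i (ordS i).
Proof. by apply/permP => x; rewrite permE. Qed.

Lemma section_gen_l i : section (gen i) [:: i] = gen i.
Proof. by apply: tree_aut_ext => v; rewrite /= /section_fun /= eqxx drop0. Qed.

Lemma section_gen_r i : section (gen i) [:: ordS i] = gen (ordS i).
Proof.
apply: tree_aut_ext => v; rewrite /= /section_fun /= drop0 eqxx.
by case: eqP => [->|].
Qed.

Lemma section_gen_id i x :
  x != i -> x != ordS i -> section (gen i) [:: x] = 1%g.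
Proof.
move=> /negPf xi /negPf xSi; apply: tree_aut_ext => v.
by rewrite /= /section_fun /= xi xSi drop0.
Qed.

Lemma gen_unique (b : 'I_d -> tree_aut d) :
    (forall i, [/\ root_perm (b i) = tperm i (ordS i),
       section (b i) [:: i] = b i, section (b i) [:: ordS i] = b (ordS i)
     & forall x, x != i -> x != ordS i -> section (b i) [:: x] = 1%g]) ->
  forall i, b i = gen i.
Proof.
move=> Hb i; apply: tree_aut_ext => u.
elim: u i => [|x u IH] i; first by rewrite tree_aut_nil.
have [br bl bS b1] := Hb i; rewrite wreathE br [RHS]/=; congr (_ :: _).
case: eqP => [->|/eqP xi]; first by rewrite bl IH.
by case: eqP => [->|/eqP xS]; [rewrite bS IH | rewrite b1].
Qed.

End Generators.

Section Growth.
Variable gT : groupType.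
Implicit Types (A G H : set gT).
Local Open Scope group_scope.

Definition is_subgroup H : Prop :=
  [/\ H 1, forall x y, H x -> H y -> H (x * y) & forall x, H x -> H x^-1].

Definition generated A : set gT := smallest is_subgroup A.

Lemma generated_subgroup A : is_subgroup (generated A).
Proof.
split=> [H [[? ? ?] ?] //|x y gx gy H|x gx H] [] sH AH.
  by have [_ HM _] := sH; apply: HM; [apply: gx | apply: gy].
by have [_ _ HV] := sH; apply: HV; apply: gx.
Qed.

Definition letter A : set gT := [set x | A x \/ A x^-1].

Definition word_ball G A (n : nat) : set gT :=
  [set g | G g /\ exists w : seq gT,
     [/\ {in w, forall x, letter A x}, (size w <= n)%N & g = \prod_(x <- w) x]].

Lemma finite_word_ball G A n : finite_set A -> finite_set (word_ball G A n).
Proof.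
move=> fA; have fL : finite_set (letter A).
  have : finite_set (A `|` [set x^-1 | x in A]).
    by rewrite finite_setU; split=> //; exact: finite_image.
  by apply: sub_finite_set => x [|Ax]; [left | right; exists x^-1; rewrite ?invgK].
suff : finite_set (word_ball setT A n).
  by apply: sub_finite_set => g [_ W]; split.
elim: n => [|n IH].
  apply: (sub_finite_set _ (finite_set1 1)) => g [_ [[|x w] [_ // _ ->]]].
  by rewrite big_nil.
have : finite_set ([set 1] `|`
    [set x * y | x in letter A & y in word_ball setT A n]).
  by rewrite finite_setU; split; [exact: finite_set1 | exact: finite_image2].
apply: sub_finite_set => g [_ [[|x w] [Lw sw ->]]].
  by left; rewrite big_nil.
right; exists x; first by apply: Lw; rewrite inE eqxx.
exists (\prod_(y <- w) y); last by rewrite big_cons.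
split=> //; exists w; split=> // y yw; apply: Lw.
by rewrite inE yw orbT.
Qed.

(* fset_set returns the empty set on infinite sets; this default value is
   never used for a finite set A, by finite_word_ball. *)
Definition growth G A (n : nat) : nat := #|` fset_set (word_ball G A n)|.

End Growth.

(* For a finitely generated group the growth function satisfies
   growth (m + n) <= growth m * growth n, so this says that the limit of its
   n-th root is greater than 1; the exponential upper bound is automatic. *)
Definition exponential_growth (R : realType) (f : nat -> nat) : Prop :=
  exists c : R, (1 < c)%R /\ forall n, (c ^+ n <= (f n)%:R)%R.

Definition gens (d : nat) : set (tree_aut d) := range (@gen d).
Arguments gens d : clear implicits.

Definition Ggroup (d : nat) : set (tree_aut d) := generated (gens d).
Arguments Ggroup d : clear implicits.

(* Main.v *)
Require Import Defs.
From mathcomp Require Import all_boot all_order all_algebra all_fingroup reals.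
From mathcomp Require Import finmap.
From mathcomp Require Import boolp classical_sets cardinality.

(** The generators a_1 and a_2 generate a free monoid, so the ball of radius n
    contains the 2 ^ n products of n factors taken from {a_1, a_2}.

    Read a positive word w as a sequence of instructions to d tokens placed on
    the vertices of the cycle Z/d, where the letter a_i exchanges the tokens at
    i and i + 1.  By the wreath recursion, a_i has section a_x at x whenever it
    moves x.  Hence the section of w at x is the positive word that lists the
    positions of the token x before each of its moves ([eval_cons]).  Such a
    word is a walk in the cycle: successive letters are neighbours; and if it is
    not empty, its first letter is x.

    A nonempty walk word is not trivial in the group ([walk_neq1]): a single
    letter moves a vertex, and in a longer walk one of the two tokens moved by
    the first letter is left in place by the second letter, so its section is a
    shorter nonempty walk word.  Two walk words with the same value are equal
    ([walk_inj]), by induction on the sum of their lengths: equal first letters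
    can be cancelled, and nonempty sections at the same vertex always have equal
    first letters, so by induction all tokens follow the same routes under both
    words.  If p is the first letter of the first word, then under
    the second word the tokens p and p + 1 also start by exchanging their
    places; a walk that reached the letter p later would use a neighbour of p
    just before and so would disturb one of these two tokens.

    Since all sections are walk words, the value of an arbitrary positive word
    determines the routes of all tokens ([trail_inj]).  For a word in a_1 and
    a_2 the first move of the token 2 reveals the first letter, and cancelling
    it gives freeness ([eval_pair_inj]). *)

Set Implicit Arguments.
Unset Strict Implicit.
Unset Printing Implicit Defensive.
Import Order.TTheory GRing.Theory Num.Theory.

(** * The cycle *)

Section Cycle.
Variable d : nat.
Hypothesis d_ge3 : 2 < d.
Implicit Types (i x y : 'I_d).

Lemma ordS_neq i : ordS i != i.
Proof.
apply/negP => /eqP /(congr1 val) /=; have := ltn_ord i.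
rewrite leq_eqVlt => /predU1P[e|lt]; last first.
  by rewrite modn_small // => /eqP; rewrite -[X in _ == X]addn0 -addn1 eqn_add2l.
by rewrite e modnn => e0; move: d_ge3; rewrite -e -e0.
Qed.

Lemma ordSS_neq i : ordS (ordS i) != i.
Proof.
apply/negP => /eqP /(congr1 val) /=; have := ltn_ord i.
rewrite leq_eqVlt => /predU1P[e|lt].
  rewrite e modnn modn_small ?(ltn_trans _ d_ge3) // => e1.
  by move: d_ge3; rewrite -e -e1.
rewrite (modn_small lt).
move: lt; rewrite leq_eqVlt => /predU1P[e|lt].
  by rewrite e modnn => e0; move: d_ge3; rewrite -e -e0.
by rewrite modn_small // => /eqP; rewrite -[X in _ == X]addn0 -addn2 eqn_add2l.
Qed.

Definition cycle_adj x y := (y == ordS x) || (x == ordS y).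

Definition move i x := tperm i (ordS i) x.

Lemma moveL i : move i i = ordS i. Proof. exact: tpermL. Qed.
Lemma moveR i : move i (ordS i) = i. Proof. exact: tpermR. Qed.
Lemma move_out i x : x != i -> x != ordS i -> move i x = x.
Proof. by move=> xi xS; rewrite /move tpermD // eq_sym. Qed.

Variant move_spec i x : 'I_d -> bool -> Type :=
  | MoveUp of x = i : move_spec i x (ordS i) false
  | MoveDown of x = ordS i : move_spec i x i false
  | MoveNot of x != i & x != ordS i : move_spec i x x true.

Lemma moveP i x : move_spec i x (move i x) (move i x == x).
Proof.
have [->|xi] := eqVneq x i.
  by rewrite moveL (negPf (ordS_neq i)); constructor.
have [->|xS] := eqVneq x (ordS i).
  by rewrite moveR eq_sym (negPf (ordS_neq i)); constructor.
by rewrite move_out // eqxx; constructor.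
Qed.

(** * Routes of tokens and sections of positive words *)

(** The positions reached by the token x at its successive moves.  The initial
    position is left out, as in [path], so that the section at x and the image
    of x are the [belast] and the [last] of the route. *)
Fixpoint trail x (w : seq 'I_d) : seq 'I_d :=
  if w is i :: w' then
    if move i x == x then trail x w' else move i x :: trail (move i x) w'
  else [::].

Definition eval (w : seq 'I_d) : tree_aut d := (\prod_(i <- w) gen i)%g.

Lemma eval0 : eval [::] = 1%g. Proof. exact: big_nil. Qed.

Lemma evalS i w : eval (i :: w) = (gen i * eval w)%g.
Proof. exact: big_cons. Qed.

Lemma eval_cancel i w w' : eval (i :: w) = eval (i :: w') -> eval w = eval w'.
Proof. by rewrite !evalS => /mulgI. Qed.

Lemma gen_cons i x v :
  gen i (x :: v) = move i x :: (if move i x == x then v else gen x v).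
Proof.
rewrite /= -/(move i x); congr (_ :: _); case: moveP => [->|->|xi xS].
- by rewrite eqxx.
- by rewrite (negPf (ordS_neq i)) eqxx.
- by rewrite (negPf xi) (negPf xS).
Qed.

(** Since [belast] drops the final position and adds the initial one, this says
    that the section of w at x lists the positions of x before its moves. *)
Lemma eval_cons w x v :
  eval w (x :: v) = last x (trail x w) :: eval (belast x (trail x w)) v.
Proof.
elim: w x v => [|i w IH] x v; first by rewrite /= !eval0.
rewrite evalS -[LHS]/(eval w (gen i (x :: v))) gen_cons IH /=.
by case: ifP => [/eqP->|_]; rewrite //= evalS.
Qed.

Lemma trail_path x w : path cycle_adj x (trail x w).
Proof.
elim: w x => [//|i w IH] x /=; case: moveP => [->|->|_ _] //=;
  by rewrite IH /cycle_adj eqxx ?orbT.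
Qed.

Lemma trail_walk x w : sorted cycle_adj (belast x (trail x w)).
Proof.
have := trail_path x w; rewrite -[path _ _ _]/(sorted _ (_ :: _)) lastI.
by rewrite -cats1 => /cat_sorted2[].
Qed.

Lemma size_trail x w : size (trail x w) <= size w.
Proof.
elim: w x => [//|i w IH] x /=; case: ifP => _ //=; exact: leq_trans (IH _) _.
Qed.

Lemma eval_trail w w' x : eval w = eval w' ->
  last x (trail x w) = last x (trail x w') /\
  eval (belast x (trail x w)) = eval (belast x (trail x w')).
Proof.
move=> e; have E v : eval w (x :: v) = eval w' (x :: v) by rewrite e.
split; first by have := E [::]; rewrite !eval_cons => -[].
by apply: tree_aut_ext => v; have := E v; rewrite !eval_cons => -[].
Qed.

(** * Walk words *)

Lemma walk_neq1 w : sorted cycle_adj w -> eval w = 1%g -> w = [::].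
Proof.
have [n] := ubnP (size w); elim: n w => // n IH [//|p [|q w]] le_n sw e1.
  have : eval [:: p] [:: p] = [:: p] by rewrite e1.
  by rewrite eval_cons /= moveL (negPf (ordS_neq p)) /= => -[/eqP];
     rewrite (negPf (ordS_neq p)).
suff [x [y [t [et le_t]]]] :
    exists x y t, trail x [:: p, q & w] = y :: t /\ size t <= size w.
  have [_] := eval_trail x (etrans e1 (esym eval0)).
  have := trail_walk x [:: p, q & w]; rewrite et => st.
  rewrite [eval (belast x (trail x [::]))]eval0 => e.
  have lt_n : size (belast x (y :: t)) < n.
    by move: le_n; rewrite size_belast ltnS; apply: leq_trans; rewrite /= !ltnS.
  by have := IH _ lt_n st e.
(* When q = p + 1 this is the token p + 1, brought to p by the first letter;
   when p = q + 1 it is the token p, brought to p + 1. *)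
have /andP[/orP[/eqP->|/eqP->] _] := sw.
- exists (ordS p), p, (trail p w); rewrite size_trail /= moveR.
  rewrite eq_sym (negPf (ordS_neq p)).
  by rewrite move_out ?eqxx // eq_sym ?ordS_neq ?ordSS_neq.
- exists (ordS q), (ordS (ordS q)), (trail (ordS (ordS q)) w).
  rewrite size_trail /= moveL (negPf (ordS_neq _)).
  by rewrite move_out ?eqxx ?ordSS_neq ?ordS_neq.
Qed.

(** The first letter that disturbs the token p or the token p + 1 has to be p,
    for otherwise one of them would leave in the wrong direction.  If this p
    were not the first letter of the walk, the letter before it would be a
    neighbour of p, which disturbs one of the two tokens as well. *)
Lemma walk_first_letter p w : sorted cycle_adj w ->
  ohead (trail p w) = Some (ordS p) -> ohead (trail (ordS p) w) = Some p ->
  ohead w = Some p.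
Proof.
elim: w => [//|q w IH] sw /=.
have [-> //|qp] := eqVneq q p.
case: (moveP q p) => [e|e|pq pSq] /=; first by rewrite e eqxx in qp.
  by move=> [e']; have := ordSS_neq q; rewrite -e -e' eqxx.
move=> hp; case: (moveP q (ordS p)) => [e|/(@ordS_inj d) e|Spq SpSq] /=.
- by move=> [e']; have := ordSS_neq p; rewrite e e' eqxx.
- by rewrite e eqxx in qp.
move=> hSp; have := IH (path_sorted sw) hp hSp.
case: w sw {IH hp hSp} => //= r w /andP[a _] [rp].
by move: a; rewrite rp /cycle_adj (negPf pSq) eq_sym (negPf Spq).
Qed.

(** Nonempty sections at x begin with the letter x in both words; cancelling it
    makes the total length drop below that of w and w', so that injectivity on
    shorter walk words is enough.  An empty section facing a nonempty one is
    excluded by [walk_neq1].  The hypothesis on shorter words makes the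
    statement usable inside the induction for [walk_inj]. *)
Lemma trail_inj_of n w w' x :
    (forall u u', size u + size u' < n -> sorted cycle_adj u ->
       sorted cycle_adj u' -> eval u = eval u' -> u = u') ->
  size w + size w' <= n -> eval w = eval w' -> trail x w = trail x w'.
Proof.
move=> IH le_n e; have [el eb] := eval_trail x e.
have := conj (trail_walk x w) (trail_walk x w').
have := leq_trans (leq_add (size_trail x w) (size_trail x w')) le_n.
case: (trail x w) (trail x w') el eb => [|y t] [|y' t'] //= el eb le_t [sw sw'].
- by have := @walk_neq1 (_ :: _) sw'; rewrite -eb eval0 => /(_ erefl).
- by have := @walk_neq1 (_ :: _) sw; rewrite eb eval0 => /(_ erefl).
have eq_b : belast y t = belast y' t'.
  apply: IH (path_sorted sw) (path_sorted sw') (eval_cancel eb).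
  by move: le_t; rewrite !size_belast addSn addnS; apply: ltnW.
by rewrite !lastI eq_b el.
Qed.

Lemma walk_inj w w' : sorted cycle_adj w -> sorted cycle_adj w' ->
  eval w = eval w' -> w = w'.
Proof.
have [n] := ubnP (size w + size w'); elim: n w w' => // n IH w w' le_n sw sw' e.
have Etrail x : trail x w = trail x w'.
  exact: trail_inj_of IH le_n e.
case: w w' sw sw' e le_n Etrail => [|p w] [|q w'] // sw sw' e le_n Etrail.
- by have := walk_neq1 sw'; rewrite -e eval0 => /(_ erefl).
- by have := walk_neq1 sw; rewrite e eval0 => /(_ erefl).
have [qp] : ohead (q :: w') = Some p.
  apply: walk_first_letter sw' _ _; rewrite -Etrail /=.
    by rewrite moveL (negPf (ordS_neq p)).
  by rewrite moveR eq_sym (negPf (ordS_neq p)).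
rewrite qp in e sw' le_n *; congr (_ :: _).
apply: IH (path_sorted sw) (path_sorted sw') (eval_cancel e).
by move: le_n; rewrite /= addSn addnS ltnS; apply: ltnW.
Qed.

(** * Free monoids in the group *)

Lemma trail_inj w w' x : eval w = eval w' -> trail x w = trail x w'.
Proof.
by apply: (@trail_inj_of (size w + size w')) => // u u' _; apply: walk_inj.
Qed.

Definition pair_word i (s : seq bool) : seq 'I_d :=
  [seq if b then ordS i else i | b <- s].

(** Every letter of such a word moves the token at i + 1, upwards or downwards
    according to the letter. *)
Lemma head_trail_pair i b s :
  ohead (trail (ordS i) (pair_word i (b :: s))) =
  Some (if b then ordS (ordS i) else i).
Proof.
by case: b => /=; rewrite ?moveL ?moveR 1?(negPf (ordS_neq _)) //
  eq_sym (negPf (ordS_neq _)).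
Qed.

Lemma eval_pair_inj i : injective (eval \o pair_word i).
Proof.
have T s s' : (eval \o pair_word i) s = (eval \o pair_word i) s' ->
    ohead (trail (ordS i) (pair_word i s)) =
    ohead (trail (ordS i) (pair_word i s')).
  by move=> /(trail_inj (ordS i)) ->.
elim=> [|b s IH] [|b' s'] // e; have := T _ _ e; rewrite !head_trail_pair //.
move=> [eh]; have eb : b = b'.
  by case: b b' eh {e} => -[] //= h; case: (elimN eqP (ordSS_neq i)).
by rewrite eb in e *; rewrite (IH s' (eval_cancel e)).
Qed.

Lemma eval_in_ball n w : size w <= n -> word_ball (Ggroup d) (gens d) n (eval w).
Proof.
move=> le_n; split.
  elim: w {le_n} => [|i w IH]; have [G1 GM _] := generated_subgroup (gens d).
    by rewrite eval0.
  by rewrite evalS; apply: GM IH => H [_]; apply; exists i.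
exists (map (@gen d) w); split; rewrite ?size_map ?big_map //.
by move=> _ /mapP[i _ ->]; left; exists i.
Qed.

Lemma growth_ge_exp2 n : 2 ^ n <= growth (Ggroup d) (gens d) n.
Proof.
pose i : 'I_d := Ordinal (ltnW (ltnW d_ge3)).
pose f (s : n.-tuple bool) := eval (pair_word i s).
have f_inj : injective f by move=> s s' /eval_pair_inj /val_inj.
have fin : finite_set (word_ball (Ggroup d) (gens d) n).
  exact/finite_word_ball/finite_image/finite_finset.
have <- : #|` [fset f s | s in {: n.-tuple bool}]%fset| = 2 ^ n.
  by rewrite card_imfset //= -cardE card_tuple card_bool.
apply: fsubset_leq_card; apply/fsubsetP => _ /imfsetP[s _ ->].
rewrite in_fset_set // inE; apply: eval_in_ball.
by rewrite size_map size_tuple.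
Qed.

End Cycle.

Theorem corollary3p6 (R : realType) (d : nat) (d_ge3 : (3 <= d)%N)
    (d_odd : odd d) :
  exponential_growth R (growth (Ggroup d) (gens d)).
Proof.
exists 2%:R%R; split=> [|n]; first by rewrite ltr1n.
by rewrite -natrX ler_nat growth_ge_exp2.
Qed.
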